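(* Let $(A,\le,0,1)$ be a bounded MLUB-complete poset, $(T,R)$ a time frame with $R$ reflexive, and $P,F,H,G$ the tense operators induced by $(T,R)$. Let $X:\mathcal P_+(A^T)\to(\mathcal P_+A)^T$ be any map. Then for every $B\in\mathcal P_+(A^T)$: $(H*X)(B)\le X(B)$, $(G*X)(B)\le X(B)$, $X(B)\le(P*X)(B)$, $X(B)\le(F*X)(B)$; in particular $P(B)\le(P*P)(B)$, $F(B)\le(F*F)(B)$, $(H*H)(B)\le H(B)$, $(G*G)(B)\le G(B)$.
   Context: For a poset and $Y\subseteq A$: $L(Y)$, $U(Y)$ the sets of lower/upper bounds, $\operatorname{Max}Y,\operatorname{Min}Y$ the maximal/minimal elements. MLUB-complete: for every nonempty $M$, every upper bound of $M$ lies above a minimal upper bound and every lower bound below a maximal lower bound. $\mathcal P_+(Y)$ = nonempty subsets. For subsets $Y,Z$: $Y\le Z$ iff $y\le z$ for all $y\in Y,z\in Z$. $A^T$ is ordered componentwise; each $Z\in(\mathcal P_+A)^T$ is identified with $\varphi(Z)=\{q\in A^T\mid q(t)\in Z(t)\ \forall t\}$ (so $Z\le Z'$ means $Z(t)\le Z'(t)$ for all $t$). A time frame is $(T,R)$, $T\ne\emptyset$, $R\subseteq T^2$. The induced tense operators $P,F,H,G:\mathcal P_+(A^T)\to(\mathcal P_+A)^T$ are $P(B)(s)=\operatorname{Min}U(\{q(t)\mid q\in B,tRs\})$, $F(B)(s)=\operatorname{Min}U(\{q(t)\mid q\in B,sRt\})$, $H(B)(s)=\operatorname{Max}L(\{q(t)\mid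 q\in B,tRs\})$, $G(B)(s)=\operatorname{Max}L(\{q(t)\mid q\in B,sRt\})$. For maps $X,Y:\mathcal P_+(A^T)\to(\mathcal P_+A)^T$, $X*Y=X\circ\varphi\circ Y$. *)

(* Defs.v *)
From HB Require Import structures.
From mathcomp Require Import all_boot all_order.
From mathcomp Require Import boolp classical_sets.

Set Implicit Arguments.
Unset Strict Implicit.
Unset Printing Implicit Defensive.

Import Order.TTheory.
Local Open Scope classical_set_scope.
Local Open Scope order_scope.

Record Pplus (Y : Type) := MkPplus {
  Pplus_set :> set Y;
  Pplus_neq0 : Pplus_set !=set0 }.

Section Posets.
Context {d : Order.disp_t} {A : porderType d}.
Implicit Types Y Z M : set A.

Definition Max Y : set A := [set y | Y y /\ forall z, Y z -> y <= z -> z = y].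
Definition Min Y : set A := [set y | Y y /\ forall z, Y z -> z <= y -> z = y].

Definition set_le Y Z : Prop := forall y z, Y y -> Z z -> y <= z.

End Posets.

Definition MLUB_complete (d : Order.disp_t) (A : porderType d) : Prop :=
  forall M : set A, M !=set0 ->
    (forall u, ubound M u -> exists2 m, Min (ubound M) m & m <= u) /\
    (forall l, lbound M l -> exists2 m, Max (lbound M) m & l <= m).

Section Families.
Context {d : Order.disp_t} {A : porderType d} {T : Type}.

Definition phi_set (Z : T -> Pplus A) : set (T -> A) :=
  [set q | forall t, (Z t : set A) (q t)].

Lemma phi_set_neq0 (Z : T -> Pplus A) : phi_set Z !=set0.
Proof.
by exists (fun t => sval (cid (Pplus_neq0 (Z t)))) => t; exact: svalP (cid _).
Qed.

Definition phi (Z : T -> Pplus A) : Pplus (T -> A) :=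
  MkPplus (phi_set_neq0 Z).

(* Families are compared through phi, as subsets of A^T, where T -> A carries
   the componentwise order of boolp; fam_leP is the pointwise reading. *)
Definition fam_le (Z Z' : T -> Pplus A) : Prop := set_le (phi Z) (phi Z').

Lemma fam_leP (Z Z' : T -> Pplus A) :
  fam_le Z Z' <-> forall t, set_le (Z t) (Z' t).
Proof.
split=> [le_ZZ' t y z Zy Z'z|le_ZZ' p q Zp Z'q]; last first.
  by apply/lefP => t; exact: le_ZZ' (Zp t) (Z'q t).
have [p Zp] := phi_set_neq0 Z; have [q Z'q] := phi_set_neq0 Z'.
pose upd (f : T -> A) a s := if pselect (s = t) then a else f s.
have Zp' : phi_set Z (upd p y) by move=> s; rewrite /upd; case: pselect => [e|_] /=; rewrite ?e.
have Z'q' : phi_set Z' (upd q z) by move=> s; rewrite /upd; case: pselect => [e|_] /=; rewrite ?e.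
have /lefP/(_ t) := le_ZZ' _ _ Zp' Z'q'.
by rewrite /upd; case: pselect.
Qed.

Definition star (X Y : Pplus (T -> A) -> T -> Pplus A) :
    Pplus (T -> A) -> T -> Pplus A :=
  X \o phi \o Y.

End Families.

Infix "<=fam" := fam_le (at level 70, no associativity).

Section TenseOperators.
Context {d : Order.disp_t} {A : tbPOrderType d} (hA : MLUB_complete A).
Context {T : Type} (R : T -> T -> Prop).

Definition past_values (B : set (T -> A)) (s : T) : set A :=
  [set a | exists q t, [/\ B q, R t s & a = q t]].
Definition future_values (B : set (T -> A)) (s : T) : set A :=
  [set a | exists q t, [/\ B q, R s t & a = q t]].

(* The set of values is empty when s has no R-predecessor (R-successor); its
   minimal upper bound is then 0 and its maximal lower bound is 1. *)
Lemma Min_ubound_neq0 (M : set A) : Min (ubound M) !=set0.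
Proof.
have [->|/set0P M0] := eqVneq M set0.
  by exists \bot; split=> // z _; rewrite lex0 => /eqP.
have /(proj1 (hA M0))[m minm _] : ubound M \top by move=> x _; exact: lex1.
by exists m.
Qed.

Lemma Max_lbound_neq0 (M : set A) : Max (lbound M) !=set0.
Proof.
have [->|/set0P M0] := eqVneq M set0.
  by exists \top; split=> // z _; rewrite le1x => /eqP.
have /(proj2 (hA M0))[m maxm _] : lbound M \bot by move=> x _; exact: le0x.
by exists m.
Qed.

Definition tenseP (B : Pplus (T -> A)) (s : T) : Pplus A :=
  MkPplus (Min_ubound_neq0 (past_values B s)).
Definition tenseF (B : Pplus (T -> A)) (s : T) : Pplus A :=
  MkPplus (Min_ubound_neq0 (future_values B s)).
Definition tenseH (B : Pplus (T -> A)) (s : T) : Pplus A :=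
  MkPplus (Max_lbound_neq0 (past_values B s)).
Definition tenseG (B : Pplus (T -> A)) (s : T) : Pplus A :=
  MkPplus (Max_lbound_neq0 (future_values B s)).

End TenseOperators.

(* Main.v *)
Require Import Defs.
From HB Require Import structures.
From mathcomp Require Import all_boot all_order.
From mathcomp Require Import boolp classical_sets.

(** Since [R s s], every [q] in [phi (X B)] contributes its own value [q s] to the past and future
    values at [s]. Members of [star H X B s] and [star G X B s] are lower bounds of these values,
    hence below [q s]; dually, those of [star P X B s] and [star F X B s] are upper bounds, hence
    above it. *)

Theorem theorem3p13 (d : Order.disp_t) (A : tbPOrderType d)
    (hA : MLUB_complete A) (T : Type) (T_neq0 : inhabited T)
    (R : T -> T -> Prop) (R_refl : forall t, R t t) :
  let P := tenseP hA R in
  let F := tenseF hA R in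
  let H := tenseH hA R in
  let G := tenseG hA R in
  (forall (X : Pplus (T -> A) -> T -> Pplus A) (B : Pplus (T -> A)),
    [/\ star H X B <=fam X B,
        star G X B <=fam X B,
        X B <=fam star P X B &
        X B <=fam star F X B]) /\
  (forall B : Pplus (T -> A),
    [/\ P B <=fam star P P B,
        F B <=fam star F F B,
        star H H B <=fam H B &
        star G G B <=fam G B]).
Proof.
move=> P F H G.
suff le_X : forall (X : Pplus (T -> A) -> T -> Pplus A) (B : Pplus (T -> A)),
    [/\ star H X B <=fam X B, star G X B <=fam X B,
        X B <=fam star P X B & X B <=fam star F X B].
  split=> // B.
  (* Each operator is itself a possible [X]. *)
  by split; [case: (le_X P B) | case: (le_X F B) | case: (le_X H B)
            | case: (le_X G B)].
(* By reflexivity, q s itself is one of the past and future values at s. *)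
move=> X B; have past q s : phi_set (X B) q -> past_values R (phi (X B)) s (q s).
  by move=> Bq; exists q, s.
have future q s : phi_set (X B) q -> future_values R (phi (X B)) s (q s).
  by move=> Bq; exists q, s.
(* The selection from [phi (X B)] is [q] in the first two goals and [p] in the last two. *)
split=> p q Zp Zq; apply/lefP => s.
- by have [lb _] := Zp s; exact: lb (past q s Zq).
- by have [lb _] := Zp s; exact: lb (future q s Zq).
- by have [ub _] := Zq s; exact: ub (past p s Zp).
- by have [ub _] := Zq s; exact: ub (future p s Zp).
Qed.
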